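(* Let $N\ge1$ and let $X=\{X_t;\ t\in\mathbf{R}^N_+\}$ be a continuous Gaussian process such that, for every $t_0\in\mathbf{R}^N_+$, almost surely the graph $\{(s',\boldsymbol{\sigma}_{t_0}(s')) : s'<0\}$ meets the region $D$. Assume that the function $t_0\mapsto\liminf_{u\to t_0}\widetilde{\alpha}^{\det}(u)$ is positive on $\mathbf{R}^N_+$. Then, almost surely, $$\forall t_0\in\mathbf{R}^N_+;\quad \liminf_{u\to t_0}\widetilde{\alpha}^{\det}(u)\ \le\ \widetilde{\boldsymbol{\alpha}}(t_0)\ \le\ \limsup_{u\to t_0}\widetilde{\alpha}^{\det}(u).$$
   Context: $\mathbf{R}^N_+=[0,\infty)^N$ with norm $\|\cdot\|$; $B(t_0,\rho)$ is the ball of centre $t_0$ and radius $\rho$ in $\mathbf{R}^N_+$; suprema of quotients with $\|t-u\|$ in the denominator are over $t\ne u$; $E[X_t-X_u]^2$ denotes $E[(X_t-X_u)^2]$. The $2$-microlocal frontier of $X$ at $t_0$ is defined for $s'\in(-\infty,0)$ by $$\boldsymbol{\sigma}_{t_0}(s')=\sup\Big\{\sigma:\ \limsup_{\rho\to0}\ \sup_{t,u\in B(t_0,\rho)}\frac{|X_t-X_u|}{\|t-u\|^{\sigma}\rho^{-s'}}<\infty\Big\}.$$ The (random) local Hölder exponent and the deterministic local Hölder exponent at $t_0$ are $$\widetilde{\boldsymbol{\alpha}}(t_0)=\sup\Big\{\alpha:\ \limsup_{\rho\to0}\sup_{t,u\in B(t_0,\rho)}\frac{|X_t-X_u|}{\|t-u\|^{\alpha}}<\infty\Big\},\qquad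 \widetilde{\alpha}^{\det}(t_0)=\sup\Big\{\alpha:\ \limsup_{\rho\to0}\sup_{t,u\in B(t_0,\rho)}\frac{E[X_t-X_u]^2}{\|t-u\|^{2\alpha}}<\infty\Big\}.$$ $D=\{(s',\sigma): -1<s'<0,\ 0<\sigma<1+s'\}$. The notations $\liminf_{u\to t_0}f(u)$ and $\limsup_{u\to t_0}f(u)$ mean $\lim_{r\to0}\inf_{u\in B(t_0,r)}f(u)$ and $\lim_{r\to0}\sup_{u\in B(t_0,r)}f(u)$, the point $u=t_0$ being included. *)

(* Defs.v *)
From HB Require Import structures.
From mathcomp Require Import all_boot all_order all_algebra.
From mathcomp Require Import all_classical all_reals all_analysis.

Set Implicit Arguments.
Unset Strict Implicit.
Unset Printing Implicit Defensive.

Import Order.TTheory GRing.Theory Num.Theory.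
Import numFieldNormedType.Exports.

Local Open Scope classical_set_scope.
Local Open Scope ring_scope.

Section Exponents.
Context {R : realType} {N : nat}.
Implicit Types (t u : 'rV[R]_N) (rho s sigma alpha : R).

Definition orthant : set 'rV[R]_N := [set t | forall i, 0 <= t 0 i].

Definition is_norm (nm : 'rV[R]_N -> R) : Prop :=
  [/\ forall x y, nm (x + y) <= nm x + nm y,
      forall a x, nm (a *: x) = `|a| * nm x &
      forall x, nm x = 0 -> x = 0].

Variable nm : 'rV[R]_N -> R.

Definition orthant_ball t0 rho : set 'rV[R]_N :=
  [set t | orthant t /\ nm (t - t0) < rho].

Definition limsup_sup t0 (q : R -> 'rV[R]_N -> 'rV[R]_N -> \bar R) : \bar R :=
  limf_esup (fun rho => ereal_sup
    [set q rho p.1 p.2 | p in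
      [set p | [/\ orthant_ball t0 rho p.1, orthant_ball t0 rho p.2
                 & p.1 != p.2]]]) 0^'+.

Definition frontier (f : 'rV[R]_N -> R) t0 s : \bar R :=
  ereal_sup [set sigma%:E | sigma in
    [set sigma | (limsup_sup t0 (fun rho t u =>
      (`|f t - f u| / (nm (t - u) `^ sigma * rho `^ (- s)))%:E) < +oo)%E]].

Definition local_holder (f : 'rV[R]_N -> R) t0 : \bar R :=
  ereal_sup [set alpha%:E | alpha in
    [set alpha | (limsup_sup t0 (fun _ t u =>
      (`|f t - f u| / nm (t - u) `^ alpha)%:E) < +oo)%E]].

Definition region_D : set (R * R) :=
  [set p | [/\ -1 < p.1, p.1 < 0, 0 < p.2 & p.2 < 1 + p.1]].

Definition graph_meets_D (f : 'rV[R]_N -> R) t0 : Prop :=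
  exists s sigma,
    [/\ s < 0, frontier f t0 s = sigma%:E & region_D (s, sigma)].

(* The point t0 itself is not removed from the balls. *)
Definition liminf_at (g : 'rV[R]_N -> \bar R) t0 : \bar R :=
  lim (ereal_inf [set g u | u in orthant_ball t0 r] @[r --> 0^'+]).

Definition limsup_at (g : 'rV[R]_N -> \bar R) t0 : \bar R :=
  lim (ereal_sup [set g u | u in orthant_ball t0 r] @[r --> 0^'+]).

Context {d : measure_display} {T : measurableType d}.
Variables (P : probability T R) (X : 'rV[R]_N -> T -> R).

Definition det_local_holder t0 : \bar R :=
  ereal_sup [set alpha%:E | alpha in
    [set alpha | (limsup_sup t0 (fun _ t u =>
      'E_P[fun w => ((X t w - X u w) ^+ 2)%R]
        * ((nm (t - u) `^ (2 * alpha))^-1)%:E) < +oo)%E]].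

End Exponents.

(* Degenerate laws are Gaussian; they are treated apart because
   [normal_prob m 0] is not the Dirac mass at [m]. *)
Definition gaussian_variable {R : realType} {d : measure_display}
    {T : measurableType d} (P : probability T R) (Y : T -> R) : Prop :=
  measurable_fun setT Y /\
  exists m s : R, 0 <= s /\
    forall A : set R, measurable A ->
      P (Y @^-1` A) = if s == 0 then \d_m A else normal_prob m s A.

(* The process is indexed by the orthant: values of X elsewhere play no role. *)
Definition gaussian_process {R : realType} {N : nat} {d : measure_display}
    {T : measurableType d} (P : probability T R)
    (X : 'rV[R]_N -> T -> R) : Prop :=
  forall (n : nat) (t : 'I_n -> 'rV[R]_N) (a : 'I_n -> R),
    (forall i, orthant (t i)) ->
    gaussian_variable P (fun w => \sum_(i < n) a i * X (t i) w).

Definition continuous_process {R : realType} {N : nat} {d : measure_display}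
    {T : measurableType d} (P : probability T R)
    (X : 'rV[R]_N -> T -> R) : Prop :=
  {ae P, forall w, {within orthant, continuous (X ^~ w)}}.

(* Main.v *)
(* For a Gaussian variable Y, a lower bound P(|Y| <= a) >= p > 0 controls both
   the mean and the standard deviation by a / p^2, hence E[Y^2] <= C_p a^2.

   Upper bound: if, at a fixed q, X is b-Hölder near q with positive (outer)
   probability, this applies with a = M ||t - u||^b to all increments near q at
   once, so the deterministic exponent at q is at least b.  A null set is thus
   discarded for each dyadic q and rational b; any t0 is approximated by dyadic q.

   Lower bound: where E[X_t - X_u]^2 <= K ||t - u||^(2a), Gaussian tails and
   Borel-Cantelli bound the increments between neighbouring dyadic points of
   level n by 2^(-gn), g < a, for all large n; chaining and path continuity
   extend this to all points.  Only countably many dyadic boxes and rational g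
   are needed, and in fact the exponent at t0 is at least the deterministic
   exponent at t0 itself, not just the liminf. *)

Require Import Defs.
From HB Require Import structures.
From mathcomp Require Import all_boot all_order all_algebra.
From mathcomp Require Import all_classical all_reals all_analysis.
From mathcomp Require Import measurable_realfun ring lra.

Set Implicit Arguments.
Unset Strict Implicit.
Unset Printing Implicit Defensive.

Import Order.TTheory GRing.Theory Num.Theory.
Import numFieldNormedType.Exports.
Local Open Scope classical_set_scope.
Local Open Scope ring_scope.

(** * Gaussian estimates *)

Lemma measurable_fun_ge d (T : measurableType d) (R : realType) (f : T -> R) x :
  measurable_fun setT f -> measurable [set w | x <= f w].
Proof.
move=> mf; rewrite [X in measurable X](_ : _ = setT `&` f @^-1` `[x, +oo[).
  exact: mf.
by rewrite setTI; apply/seteqP; split => y /=; rewrite in_itv/= andbT.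
Qed.

Lemma measurable_fun_le d (T : measurableType d) (R : realType) (f : T -> R) x :
  measurable_fun setT f -> measurable [set w | f w <= x].
Proof.
move=> mf; rewrite [X in measurable X](_ : _ = setT `&` f @^-1` `]-oo, x]).
  exact: mf.
by rewrite setTI; apply/seteqP; split => y /=; rewrite in_itv.
Qed.

(* Half of the Gaussian exponent is kept as a density of variance 2 s^2; the
   other half absorbs tails and polynomial factors without computing moments. *)
Lemma normal_pdf_split (R : realType) (m s y : R) : 0 < s ->
  normal_pdf m s y = Num.sqrt 2 * expR (- (y - m) ^+ 2 / (4 * s ^+ 2)) *
                     normal_pdf m (Num.sqrt 2 * s) y.
Proof.
move=> s0.
have r2 : 0 < Num.sqrt 2 :> R by rewrite sqrtr_gt0.
have r2s : 0 < Num.sqrt 2 * s by rewrite mulr_gt0.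
rewrite !normal_pdfE ?gt_eqF// /normal_peak /normal_fun exprMn sqr_sqrtr//.
rewrite mulrACA; congr (_ * _).
  have -> : 2 * s ^+ 2 * pi *+ 2 = 2 * (s ^+ 2 * pi *+ 2) by rewrite -!mulrnAr mulrA.
  by rewrite (sqrtrM (s ^+ 2 * pi *+ 2)) ?ler0n// invfM mulrA divff ?mul1r// gt_eqF.
rewrite -expRD; congr expR.
have s20 : s ^+ 2 != 0 by rewrite expf_neq0// gt_eqF.
by field; rewrite gt_eqF.
Qed.

Lemma expRN_le_fact (R : realType) (z : R) k : 0 < z ->
  expR (- z) <= k`!%:R / z ^+ k.
Proof.
move=> z0; case: k => [|k]; first by rewrite divr1 -expR0 ler_expR oppr_le0 ltW.
rewrite expRN -invf_div lef_pV2 ?posrE ?expR_gt0 ?divr_gt0 ?exprn_gt0 ?ltr0n ?fact_gt0//.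
by apply: le_trans (expR_ge1Dxn k (ltW z0)); rewrite lerDr.
Qed.

(** On the tail the split-off exponential is at most [expR (- (x ^+ 2 / (4 * s ^+ 2)))], hence
    polynomially small to any order [k], and the remaining density has mass at most 1. The order
    stays free so that it can later outweigh the number of pairs of grid points. *)
Lemma normal_prob_tail (R : realType) (m s x : R) k : 0 < s -> 0 < x ->
  (normal_prob m s [set y | (x <= `|y - m|)%R] <=
     (2 * k`!%:R * (4 * s ^+ 2 / x ^+ 2) ^+ k)%:E)%E.
Proof.
move=> s0 x0; set A := [set y | _].
have mA : measurable A.
  apply: measurable_fun_ge; apply: measurableT_comp => //.
  exact: measurable_funB.
have s2 : 0 < 4 * s ^+ 2 by rewrite mulr_gt0 ?exprn_gt0.
set c := 2 * k`!%:R * _.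
have c0 : 0 <= c by rewrite !mulr_ge0 ?exprn_ge0 ?divr_ge0 ?sqr_ge0 ?ltW.
have pdfle y : A y -> normal_pdf m s y <= c * normal_pdf m (Num.sqrt 2 * s) y.
  rewrite /A/= => xy; rewrite normal_pdf_split// ler_wpM2r ?normal_pdf_ge0//.
  rewrite /c -mulrA ler_pM ?sqrtr_ge0 ?expR_ge0//.
    by rewrite -[leRHS]ger0_norm// -sqrtr_sqr ler_wsqrtr// expr2; lra.
  have x2 : 0 < x ^+ 2 by rewrite exprn_gt0.
  apply: (@le_trans _ _ (expR (- (x ^+ 2 / (4 * s ^+ 2))))).
    rewrite ler_expR mulNr lerN2 ler_wpM2r ?invr_ge0 ?(ltW s2)//.
    by rewrite -[leRHS]real_normK ?num_real// ler_sqr ?nnegrE// ltW.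
  apply: le_trans (expRN_le_fact k _) _; first by rewrite divr_gt0.
  by rewrite -exprVn invf_div.
rewrite /normal_prob.
apply: (@le_trans _ _ (\int[lebesgue_measure]_(x in A)
    (c%:E * (normal_pdf m (Num.sqrt 2 * s) x)%:E))%E).
  apply: ge0_le_integral => //=.
  - by move=> y _; rewrite lee_fin normal_pdf_ge0.
  - by apply/measurable_EFinP/measurable_funTS; exact: measurable_normal_pdf.
  - apply: measurable_funeM; apply/measurable_EFinP/measurable_funTS.
    exact: measurable_normal_pdf.
rewrite ge0_integralZl//=; last 2 first.
  - by apply/measurable_EFinP/measurable_funTS; exact: measurable_normal_pdf.
  - by move=> y _; rewrite lee_fin normal_pdf_ge0.
rewrite -[leRHS]mule1 lee_pmul//.
- by apply: integral_ge0 => y _; rewrite lee_fin normal_pdf_ge0.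
- by have := @probability_le1 _ _ _ (normal_prob m (Num.sqrt 2 * s)) A mA.
Qed.

(** Integration against the law goes through its Radon-Nikodym derivative, which equals the density
    almost everywhere because both have the same integral over every measurable set. *)
Lemma ge0_integral_normal_prob (R : realType) (m s : R) (f : R -> \bar R) :
  (forall x, 0 <= f x)%E -> measurable_fun setT f ->
  (\int[normal_prob m s]_x f x =
     \int[lebesgue_measure]_x (f x * (normal_pdf m s x)%:E))%E.
Proof.
move=> f0 mf.
have dom := normal_prob_dominates m s.
rewrite -(Radon_Nikodym_SigmaFinite.change_of_variables dom)//.
have intf := Radon_Nikodym_SigmaFinite.f_integrable dom.
apply: ae_eq_integral => //.
- by apply: emeasurable_funM => //; apply: measurable_int intf.
- apply: emeasurable_funM => //; apply/measurable_EFinP.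
  exact: measurable_normal_pdf.
- apply: ae_eqe_mul2l; apply: integral_ae_eq => //.
  + by apply/measurable_EFinP; exact: measurable_normal_pdf.
  + by move=> E _ mE; rewrite -Radon_Nikodym_SigmaFinite.f_integral.
Qed.

(** Since [y ^+ 2 <= 2 * m ^+ 2 + 2 * (y - m) ^+ 2] and half of the exponent absorbs [(y - m) ^+ 2],
    the integrand is dominated by a combination of two Gaussian densities, each of integral 1. *)
Lemma normal_prob_second_moment (R : realType) (m s : R) : 0 < s ->
  (\int[normal_prob m s]_y (y ^+ 2)%:E <= (2 * m ^+ 2 + 16 * s ^+ 2)%:E)%E.
Proof.
move=> s0; have s2 : 0 < s ^+ 2 by rewrite exprn_gt0.
rewrite ge0_integral_normal_prob//; last 2 first.
  by move=> y; rewrite lee_fin sqr_ge0.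
  by apply/measurable_EFinP; exact: measurable_funX.
pose r := Num.sqrt 2 * s.
apply: (@le_trans _ _ (\int[lebesgue_measure]_y
    ((2 * m ^+ 2)%:E * (normal_pdf m s y)%:E +
     (16 * s ^+ 2)%:E * (normal_pdf m r y)%:E))%E).
  apply: ge0_le_integral => //=.
  - by move=> y _; rewrite mule_ge0 ?lee_fin ?sqr_ge0 ?normal_pdf_ge0.
  - apply: emeasurable_funM; apply/measurable_EFinP; last exact: measurable_normal_pdf.
    exact: measurable_funX.
  - by apply: emeasurable_funD; apply: measurable_funeM; apply/measurable_EFinP;
      exact: measurable_normal_pdf.
  move=> y _; rewrite -!EFinM -EFinD lee_fin.
  have y2 : y ^+ 2 <= 2 * m ^+ 2 + 2 * (y - m) ^+ 2.
    by have := sqr_ge0 (y - 2 * m); rewrite !expr2; lra.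
  apply: le_trans (ler_wpM2r (normal_pdf_ge0 _ _ _) y2) _.
  rewrite mulrDl lerD2l normal_pdf_split// mulrA ler_wpM2r ?normal_pdf_ge0//.
  (* The exponential bound needs a positive argument, so [y = m] is treated apart. *)
  have [->|ym] := eqVneq y m; first by rewrite subrr expr0n/= mulr0 mul0r mulr_ge0 ?ltW.
  have z0 : 0 < (y - m) ^+ 2 by rewrite exprn_even_gt0//= subr_eq0.
  have := @expRN_le_fact _ ((y - m) ^+ 2 / (4 * s ^+ 2)) 1.
  have -> : 0 < (y - m) ^+ 2 / (4 * s ^+ 2) by rewrite divr_gt0 // mulr_gt0.
  move=> /(_ isT).
  rewrite factS fact0 muln1 expr1 invf_div mul1r mulNr ler_pdivlMr//.
  set e := expR _ => ez.
  have e0 : 0 <= e by exact: expR_ge0.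
  have r2 : Num.sqrt 2 <= 2 :> R.
    by rewrite -[leRHS]ger0_norm// -sqrtr_sqr ler_wsqrtr// expr2; lra.
  have : Num.sqrt 2 * (e * (y - m) ^+ 2) <= 2 * (4 * s ^+ 2).
    by apply: ler_pM => //; apply: mulr_ge0 => //; exact: ltW.
  move: (Num.sqrt 2) => r2' h.
  have -> : 2 * (y - m) ^+ 2 * (r2' * e) = 2 * (r2' * (e * (y - m) ^+ 2)) by ring.
  by lra.
have m2 : 0 <= 2 * m ^+ 2 by rewrite mulr_ge0 ?sqr_ge0.
have s16 : 0 <= 16 * s ^+ 2 by rewrite mulr_ge0 ?sqr_ge0.
have pdf0 t y : (0 <= (normal_pdf m t y)%:E)%E by rewrite lee_fin normal_pdf_ge0.
have mpdf t : measurable_fun setT (fun y => (normal_pdf m t y)%:E).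
  by apply/measurable_EFinP; exact: measurable_normal_pdf.
rewrite ge0_integralD//=; last 4 first.
  - by move=> y _; apply: mule_ge0; rewrite ?lee_fin// normal_pdf_ge0.
  - by apply: measurable_funeM; exact: mpdf.
  - by move=> y _; apply: mule_ge0; rewrite ?lee_fin// normal_pdf_ge0.
  - by apply: measurable_funeM; exact: mpdf.
rewrite !ge0_integralZl// ?integral_normal_pdf ?mule1 -?EFinD//; exact: mpdf.
Qed.

(** The density is at most [s^-1] and the interval has length [2 * a]. *)
Lemma normal_prob_small_ball (R : realType) (m s a : R) : 0 < s -> 0 <= a ->
  (normal_prob m s [set y | (`|y| <= a)%R] <= (2 * a / s)%:E)%E.
Proof.
move=> s0 a0.
have -> : [set y : R | `|y| <= a] = `[- a, a]%classic.
  by apply/seteqP; split => y /=; rewrite in_itv/= ler_norml.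
rewrite /normal_prob.
apply: (@le_trans _ _ (\int[lebesgue_measure]_(x in `[(- a)%R, a]) (s^-1)%:E)%E).
  apply: ge0_le_integral => //=.
  - by move=> y _; rewrite lee_fin normal_pdf_ge0.
  - by apply/measurable_EFinP/measurable_funTS; exact: measurable_normal_pdf.
  - move=> y _; rewrite lee_fin; apply: le_trans (normal_pdf_ub _ _ _) _.
      by rewrite gt_eqF.
    rewrite /normal_peak lef_pV2 ?posrE//; last first.
      by rewrite sqrtr_gt0 mulrn_wgt0// mulr_gt0 ?pi_gt0// exprn_gt0.
    rewrite -[leLHS]gtr0_norm// -sqrtr_sqr ler_wsqrtr//.
    rewrite -mulrnAr ler_peMr ?sqr_ge0//.
    by have := @pi_ge2 R; rewrite mulr2n; lra.
rewrite integral_cst//= lebesgue_measure_itv/= lte_fin.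
case: ltP => aa; last first.
  by rewrite mule0 lee_fin; apply: divr_ge0; [exact: mulr_ge0|exact: ltW].
by rewrite -EFinD -EFinM lee_fin opprK mulrC -mulr2n mulr_natl.
Qed.

Section GaussianVariable.
Context {R : realType} {d : measure_display} {T : measurableType d}.
Variables (P : probability T R) (Y : T -> R) (m s : R).
Hypotheses (mY : measurable_fun setT Y) (s0 : 0 <= s).
Hypothesis lawY : forall A : set R, measurable A ->
  P (Y @^-1` A) = if s == 0 then \d_m A else normal_prob m s A.

Let small_ball_set a : measurable [set y : R | `|y| <= a].
Proof. exact: measurable_fun_le. Qed.

(** A widely spread law gives little mass to [[-a, a]], which bounds [s]; once [s] is bounded, a
    mean far from this interval would leave it in the tail. *)
Lemma gaussian_parameters_bound (a p : R) : 0 <= a -> 0 < p ->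
  (p%:E <= P [set w | (`|Y w| <= a)%R])%E ->
  `|m| <= 9 * a / p ^+ 2 /\ s <= 9 * a / p ^+ 2.
Proof.
move=> a0 p0 pP.
have p1 : p <= 1.
  rewrite -lee_fin; apply: le_trans pP _; apply: probability_le1.
  by apply: measurable_fun_le; apply: measurableT_comp.
have p20 : 0 < p ^+ 2 by rewrite exprn_gt0.
have p2p : p ^+ 2 <= p by rewrite expr2 ger_pMl.
have p21 : p ^+ 2 <= 1 by rewrite expr_le1 // ltW.
have ap : a <= a / p ^+ 2 by rewrite ler_pdivlMr// ler_piMr.
rewrite -mulrA; move: pP; rewrite (lawY (small_ball_set a)).
have [->|sn0] := eqVneq s 0.
  rewrite diracE; case: (boolP (m \in _)) => [|_]; last by rewrite lee_fin leNgt p0.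
  rewrite inE/= => am _.
  split; last by rewrite mulr_ge0// divr_ge0// ltW.
  apply: le_trans am _; apply: le_trans ap _.
  by rewrite ler_peMl ?divr_ge0 ?(ltW p20)//; lra.
have {sn0}s1 : 0 < s by rewrite lt_neqAle eq_sym sn0.
move=> pP.
have : (p%:E <= (2 * a / s)%:E)%E.
  by apply: le_trans pP _; exact: normal_prob_small_ball.
rewrite lee_fin ler_pdivlMr// => psa.
have sp : s <= 2 * (a / p ^+ 2).
  apply: (@le_trans _ _ (2 * (a / p))).
    by rewrite mulrA ler_pdivlMr// mulrC.
  by rewrite ler_pM2l// ler_wpM2l// lef_pV2.
split; last first.
  by apply: le_trans sp _; rewrite ler_wpM2r ?divr_ge0 ?(ltW p20)//; lra.
case: (leP `|m| a) => [ma|am].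
  apply: le_trans ma _; apply: le_trans ap _.
  by rewrite ler_peMl ?divr_ge0 ?(ltW p20)//; lra.
(* Now [|Y| <= a] forces [|Y - m| >= x]. The tail bound of order 1 gives [p * x ^+ 2 <= 8 * s ^+ 2],
   so [x <= 4 * s / p <= 8 * a / p ^+ 2]; adding [a] back produces the factor 9. *)
pose x := `|m| - a.
have x0 : 0 < x by rewrite subr_gt0.
have : (p%:E <= (2 * 1`!%:R * (4 * s ^+ 2 / x ^+ 2) ^+ 1)%:E)%E.
  apply: le_trans (normal_prob_tail m 1 s1 x0); apply: le_trans pP _.
  apply: le_measure; rewrite ?inE.
  - exact: small_ball_set.
  - by apply: measurable_fun_ge; apply: measurableT_comp => //; exact: measurable_funB.
  move=> y /= ya; rewrite /x lerBlDr.
  have := ler_normD (m - y) y; rewrite subrK distrC => h.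
  by apply: le_trans h _; rewrite lerD2l.
rewrite lee_fin (_ : 1`! = 1%N)// mulr1 expr1 mulrA ler_pdivlMr ?exprn_gt0// => h.
have : x <= 4 * (s / p).
  rewrite -ler_sqr ?nnegrE ?(ltW x0)//; last by rewrite mulr_ge0// divr_ge0// ltW.
  rewrite exprMn expr_div_n mulrA ler_pdivlMr//.
  apply: (@le_trans _ _ (p * x ^+ 2)); first by rewrite mulrC ler_wpM2r ?sqr_ge0.
  by apply: le_trans h _; have := sqr_ge0 s; rewrite !expr2; lra.
have : s / p <= 2 * (a / p ^+ 2).
  by rewrite ler_pdivrMr// expr2 invfM !mulrA divfK ?gt_eqF// ler_pdivlMr// mulrC.
rewrite /x; lra.
Qed.

Lemma gaussian_second_moment :
  (\int[P]_w (Y w ^+ 2)%:E <= (2 * m ^+ 2 + 16 * s ^+ 2)%:E)%E.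
Proof.
have mf : measurable_fun setT (fun y : R => (y ^+ 2)%:E).
  by apply/measurable_EFinP; exact: measurable_funX.
have f0 y : (0 <= (y ^+ 2)%:E :> \bar R)%E by rewrite lee_fin sqr_ge0.
have [s_eq|sn0] := eqVneq s 0.
  have -> : (\int[P]_w (Y w ^+ 2)%:E = \int[pushforward P Y]_y (y ^+ 2)%:E)%E.
    by rewrite ge0_integral_pushforward.
  rewrite (eq_measure_integral (\d_m : {measure set R -> \bar R})); last first.
    by move=> A mA _; rewrite -[LHS]/(P (Y @^-1` A)) lawY// s_eq eqxx.
  rewrite integral_dirac// diracT mul1e lee_fin s_eq.
  by have := sqr_ge0 m; rewrite !expr2; lra.
have -> : (\int[P]_w (Y w ^+ 2)%:E =
    \int[pushforward P (Y : T -> measurableTypeR R)]_y ((y : R) ^+ 2)%:E)%E.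
  by rewrite ge0_integral_pushforward.
rewrite (eq_measure_integral (normal_prob m s)); last first.
  by move=> A mA _; rewrite -[LHS]/(P (Y @^-1` A)) lawY// (negbTE sn0).
by apply: normal_prob_second_moment; rewrite lt_neqAle eq_sym sn0.
Qed.

(** For [x <= 2 * K] the right-hand side is at least 1. Otherwise [|m| <= K < x / 2], so [|Y| >= x]
    entails [|Y - m| >= x / 2], and the centred tail bound applies. *)
Lemma gaussian_tail_of_parameters (K x : R) k : 0 < x -> `|m| <= K -> s <= K ->
  (P [set w | (x <= `|Y w|)%R] <= (2 * k`!%:R * (16 * K ^+ 2 / x ^+ 2) ^+ k)%:E)%E.
Proof.
move=> x0 mK sK.
have K0 : 0 <= K := le_trans (normr_ge0 _) mK.
have mA : measurable [set y : R | x <= `|y|] by exact: measurable_fun_ge.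
have x20 : 0 < x ^+ 2 by rewrite exprn_gt0.
have c0 t : 0 <= 16 * t ^+ 2 / x ^+ 2.
  by apply: divr_ge0; [apply: mulr_ge0 => //|]; exact: sqr_ge0.
have fk : 1 <= k`!%:R :> R by rewrite ler1n fact_gt0.
case: (leP x (2 * K)) => [xK|Kx].
  apply: (@le_trans _ _ 1%E).
    by apply: probability_le1; apply: measurable_fun_ge; exact: measurableT_comp.
  rewrite lee_fin -[leLHS]mulr1 ler_pM//.
    by lra.
  apply: exprn_ege1; rewrite ler_pdivlMr// mul1r.
  have : x ^+ 2 <= (2 * K) ^+ 2 by rewrite ler_sqr ?nnegrE ?mulr_ge0 ?(ltW x0).
  by rewrite exprMn; have := sqr_ge0 K; rewrite !expr2; lra.
rewrite (lawY mA).
have [_|sn0] := eqVneq s 0.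
  rewrite diracE; case: (boolP (m \in _)) => /= [|_]; last first.
    by rewrite lee_fin !mulr_ge0 ?exprn_ge0.
  rewrite inE/= => xm.
  by exfalso; have : x <= K by [exact: le_trans xm mK]; lra.
have {sn0}s1 : 0 < s by rewrite lt_neqAle eq_sym sn0.
have x20' : 0 < x / 2 by rewrite divr_gt0.
apply: le_trans (_ : (_ <= (2 * k`!%:R * (4 * s ^+ 2 / (x / 2) ^+ 2) ^+ k)%:E)%E) _.
  apply: le_trans (normal_prob_tail m k s1 x20'); apply: le_measure; rewrite ?inE//.
  - by apply: measurable_fun_ge; apply: measurableT_comp => //; exact: measurable_funB.
  - move=> y /= xy; have := ler_normD (y - m) m; rewrite subrK => h.
  by lra.
have e : 4 * s ^+ 2 / (x / 2) ^+ 2 = 16 * s ^+ 2 / x ^+ 2.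
  by field; rewrite gt_eqF.
rewrite e lee_fin ler_wpM2l ?mulr_ge0// lerXn2r ?nnegrE//.
by rewrite ler_wpM2r ?invr_ge0 ?sqr_ge0// ler_wpM2l// ler_sqr ?nnegrE// ltW.
Qed.

End GaussianVariable.

Lemma gaussian_second_moment_le (R : realType) d (T : measurableType d)
    (P : probability T R) (Y : T -> R) (a p : R) :
  gaussian_variable P Y -> 0 <= a -> 0 < p ->
  (p%:E <= P [set w | (`|Y w| <= a)%R])%E ->
  (\int[P]_w (Y w ^+ 2)%:E <= (18 * (9 * a / p ^+ 2) ^+ 2)%:E)%E.
Proof.
move=> [mY [m [s [s0 lawY]]]] a0 p0 pP.
have [mb sb] := gaussian_parameters_bound mY s0 lawY a0 p0 pP.
apply: le_trans (gaussian_second_moment mY s0 lawY) _.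
rewrite lee_fin; set b := 9 * a / p ^+ 2 in mb sb *.
have b0 : 0 <= b := le_trans (normr_ge0 _) mb.
have m2 : m ^+ 2 <= b ^+ 2 by rewrite -[leLHS]real_normK ?num_real// ler_sqr ?nnegrE.
have s2 : s ^+ 2 <= b ^+ 2 by rewrite ler_sqr ?nnegrE.
by move: m2 s2; rewrite !expr2; lra.
Qed.

(** Chebyshev's inequality at twice the root of [K] leaves mass at least 3/4 near 0, which bounds
    the parameters of the law without identifying them with moments. *)
Lemma gaussian_tail (R : realType) d (T : measurableType d)
    (P : probability T R) (Y : T -> R) (K x : R) k :
  gaussian_variable P Y -> 0 < K -> 0 < x ->
  (\int[P]_w (Y w ^+ 2)%:E <= K%:E)%E ->
  (P [set w | (x <= `|Y w|)%R] <=
     (2 * k`!%:R * (128 ^+ 2 * K / x ^+ 2) ^+ k)%:E)%E.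
Proof.
move=> [mY [m [s [s0 lawY]]]] K0 x0 EK.
pose r := Num.sqrt K.
have r0 : 0 < r by rewrite sqrtr_gt0.
have rK : r ^+ 2 = K by rewrite sqr_sqrtr// ltW.
have mge : measurable [set w | 2 * r <= `|Y w|].
  by apply: measurable_fun_ge; exact: measurableT_comp.
have cheb : (P [set w | (2 * r <= `|Y w|)%R] <= (4^-1)%:E)%E.
  suff : ((4 * K)%:E * P [set w | (2 * r <= `|Y w|)%R] <= K%:E)%E.
    rewrite -lee_pdivlMl ?mulr_gt0// => h; apply: le_trans h _.
    by rewrite -EFinM lee_fin invfM -mulrA mulVf ?mulr1// gt_eqF.
  apply: le_trans EK.
  rewrite -[X in P X]setIT -integral_cst//; last by rewrite setIT.
  rewrite setIT integral_mkcond; apply: ge0_le_integral => //=.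
  - by move=> w _; rewrite patchE; case: ifP => // _; rewrite lee_fin mulr_ge0 ?ltW.
  - by apply/(measurable_restrictT _ _).1 => //; exact: measurable_cst.
  - by apply/measurable_EFinP; exact: measurable_funX.
  move=> w _; rewrite patchE; case: ifPn => [|_]; last by rewrite lee_fin sqr_ge0.
  rewrite inE/= => h; rewrite lee_fin -rK -[leRHS]real_normK ?num_real//.
  have -> : 4 * r ^+ 2 = (2 * r) ^+ 2 by ring.
  by rewrite ler_sqr ?nnegrE// mulr_ge0// ltW.
have mid : ((3 / 4)%:E <= P [set w | (`|Y w| <= 2 * r)%R])%E.
  apply: (@le_trans _ _ (P (~` [set w | (2 * r <= `|Y w|)%R]))).
    rewrite probability_setC// (_ : 3 / 4 = 1 - 4^-1 :> R); last by field.
    by rewrite EFinB leeB.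
  apply: le_measure; rewrite ?inE//.
  - exact: measurableC.
  - by apply: measurable_fun_le; apply: measurableT_comp.
  - by move=> w /= /negP; rewrite -ltNge => /ltW.
have p34 : 0 < 3 / 4 :> R by rewrite divr_gt0.
have [] := gaussian_parameters_bound mY s0 lawY _ p34 mid.
  by rewrite mulr_ge0// ltW.
(* The parameter bound with [a = 2 * r] and [p = 3 / 4] is [32 * r], and
   [16 * 32 ^+ 2 = 128 ^+ 2]. *)
rewrite (_ : 9 * (2 * r) / (3 / 4) ^+ 2 = 32 * r); last by field.
move=> mb sb; have := gaussian_tail_of_parameters mY s0 lawY k x0 mb sb.
suff -> : 16 * (32 * r) ^+ 2 = 128 ^+ 2 * K by [].
by rewrite -rK; ring.
Qed.

(** * Dyadic chaining *)

Lemma rV_norm_le (R : realType) N (x : 'rV[R]_N) e :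
  0 <= e -> (forall i, `|x 0 i| <= e) -> `|x| <= e.
Proof.
move=> e0 xe; rewrite /Num.norm/= mx_normrE; apply: bigmax_le => // -[i j] _ /=.
by rewrite ord1.
Qed.

Lemma rV_coord_le_norm (R : realType) N (x : 'rV[R]_N) i : `|x 0 i| <= `|x|.
Proof.
rewrite [leRHS]/Num.norm/= mx_normrE; apply/bigmax_geP; right => /=.
by exists (0, i).
Qed.

Section DyadicGrid.
Context {R : realType} {N : nat}.
Implicit Types (t u : 'rV[R]_N) (k : {ffun 'I_N -> nat}).

(** Indices are natural numbers, so grid points never leave the orthant. *)
Definition grid_point n k : 'rV[R]_N := \row_i ((k i)%:R * 2^-1 ^+ n).

Definition dyadic_index n t : {ffun 'I_N -> nat} :=
  [ffun i => Num.truncn (t 0 i * 2 ^+ n)].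

Definition dyadic_approx n t := grid_point n (dyadic_index n t).

Lemma half_exp_gt0 n : 0 < 2^-1 ^+ n :> R.
Proof. by rewrite exprn_gt0// invr_gt0. Qed.

Lemma half_exp_mul n : 2 ^+ n * 2^-1 ^+ n = 1 :> R.
Proof. by rewrite -exprMn mulfV// expr1n. Qed.

Lemma half_exp_small (e : R) : 0 < e -> exists n, 2^-1 ^+ n < e.
Proof.
move=> e0.
have h : (2^-1 : R) ^+ n @[n --> \oo] --> (0 : R).
  by apply: cvg_expr; rewrite ger0_norm ?invr_ge0// invf_lt1// ltr1n.
move/cvgrPdist_lt: h => /(_ e e0)[n _ hn].
exists n; move: (hn n (leqnn n)).
by rewrite /= sub0r normrN ger0_norm ?(ltW (half_exp_gt0 n)).
Qed.

(** The grids are nested, so two successive approximations can be compared as points of the finer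
    one. *)
Lemma grid_point_succ n k :
  grid_point n k = grid_point n.+1 [ffun i => (2 * k i)%N].
Proof. by apply/rowP => i; rewrite !mxE ffunE natrM exprS; field. Qed.

Lemma grid_point_orthant n k : orthant (grid_point n k).
Proof. by move=> i; rewrite mxE mulr_ge0// ltW// half_exp_gt0. Qed.

Lemma truncn_dyadic n t i : orthant t ->
  (Num.truncn (t 0 i * 2 ^+ n))%:R <= t 0 i * 2 ^+ n <
  (Num.truncn (t 0 i * 2 ^+ n)).+1%:R.
Proof. by move=> ot; apply: truncn_itv; rewrite mulr_ge0// exprn_ge0. Qed.

Lemma dyadic_approx_dist n t : orthant t -> `|t - dyadic_approx n t| <= 2^-1 ^+ n.
Proof.
move=> ot; apply: rV_norm_le => [|i]; first exact/ltW/half_exp_gt0.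
rewrite !mxE ffunE; have /andP[lo up] := truncn_dyadic n i ot.
move: lo up; set z := Num.truncn _ => lo up.
have -> : t 0 i - z%:R * 2^-1 ^+ n = (t 0 i * 2 ^+ n - z%:R) * 2^-1 ^+ n.
  by rewrite mulrBl -mulrA half_exp_mul mulr1.
rewrite normrM (gtr0_norm (half_exp_gt0 n)) ler_piMl ?(ltW (half_exp_gt0 n))//.
by move: up; rewrite -natr1 ger0_norm ?subr_ge0//; lra.
Qed.

(** If [z] is the integer part of [y], that of [2 * y] is [2 * z] or [2 * z + 1]. *)
Lemma dyadic_approx_succ n t : orthant t ->
  `|dyadic_approx n.+1 t - dyadic_approx n t| <= 2^-1 ^+ n.+1.
Proof.
move=> ot; apply: rV_norm_le => [|i]; first exact/ltW/half_exp_gt0.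
rewrite !mxE !ffunE.
have /andP[lo up] := truncn_dyadic n i ot.
have /andP[lo' up'] := truncn_dyadic n.+1 i ot.
move: lo up lo' up'; set z := Num.truncn (_ * 2 ^+ n); set z' := Num.truncn _.
rewrite exprS mulrCA => lo up lo' up'.
have h1 : (2 * z < z'.+1)%N.
  by rewrite -(ltr_nat R) natrM; apply: le_lt_trans up'; rewrite ler_pM2l.
have h2 : (z' < 2 * z.+1)%N.
  by rewrite -(ltr_nat R) natrM; apply: le_lt_trans lo' _; rewrite ltr_pM2l.
have -> : z'%:R * 2^-1 ^+ n.+1 - z%:R * 2^-1 ^+ n =
    (z'%:R - (2 * z)%:R) * 2^-1 ^+ n.+1 :> R.
  by rewrite natrM exprS; field.
rewrite normrM (gtr0_norm (half_exp_gt0 n.+1)) ler_piMl ?(ltW (half_exp_gt0 n.+1))//.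
have : (2 * z <= z' <= (2 * z).+1)%N by rewrite -ltnS h1/= -ltnS; move: h2; rewrite mulnS.
move=> /andP[]; rewrite -2!(ler_nat R) -natr1 => a b.
by rewrite ger0_norm; lra.
Qed.

(** In each coordinate, nonnegative reals at distance at most 1 have integer parts differing by at
    most 1. *)
Lemma dyadic_approx_near n t u : orthant t -> orthant u ->
  `|t - u| <= 2^-1 ^+ n ->
  `|dyadic_approx n t - dyadic_approx n u| <= 2^-1 ^+ n.
Proof.
move=> ot ou tu; apply: rV_norm_le => [|i]; first exact/ltW/half_exp_gt0.
rewrite !mxE !ffunE -mulrBl normrM (gtr0_norm (half_exp_gt0 n)).
rewrite ler_piMl ?(ltW (half_exp_gt0 n))//.
have /andP[lo up] := truncn_dyadic n i ot.
have /andP[lo' up'] := truncn_dyadic n i ou.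
have : `|t 0 i * 2 ^+ n - u 0 i * 2 ^+ n| <= 1.
  rewrite -mulrBl normrM (gtr0_norm (_ : 0 < 2 ^+ n))// ?exprn_gt0//.
  rewrite -[leRHS](half_exp_mul n) [leRHS]mulrC ler_wpM2r ?exprn_ge0//.
  by apply: le_trans tu; have := rV_coord_le_norm (t - u) i; rewrite !mxE.
move: lo up lo' up'; set z := Num.truncn _; set z' := Num.truncn _ => lo up lo' up'.
rewrite ler_norml => /andP[a b].
have h1 : (z < z'.+2)%N by rewrite -(ltr_nat R) -natr1; lra.
have h2 : (z' < z.+2)%N by rewrite -(ltr_nat R) -natr1; lra.
by move: h1 h2; rewrite !ltnS -2!(ler_nat R) -!natr1 ler_norml => h1 h2; lra.
Qed.

Lemma dyadic_approx_cvg (f : 'rV[R]_N -> R) t : {within orthant, continuous f} ->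
  orthant t -> f (dyadic_approx n t) @[n --> \oo] --> f t.
Proof.
move=> cf ot.
have /subspace_continuousP/(_ t ot)/cvgrPdist_lt ft := cf.
apply/cvgrPdist_lt => e e0.
have := ft e e0; rewrite near_withinE => /nbhs_ballP[/= r r0 hr].
have [n0 hn0] := half_exp_small r0.
exists n0 => // n /= n0n; apply: hr; last exact: grid_point_orthant.
rewrite -ball_normE/=; apply: le_lt_trans (dyadic_approx_dist n ot) _.
by apply: le_lt_trans hn0; rewrite ler_wiXn2l// ?invr_ge0// invf_le1// ler1n.
Qed.

(** Neighbours are meant in the sup norm, so diagonal ones count. *)
Definition grid_increments_le (f : 'rV[R]_N -> R) (U : set 'rV[R]_N) (theta : R) n :=
  forall k k', U (grid_point n k) -> U (grid_point n k') ->
    `|grid_point n k - grid_point n k'| <= 2^-1 ^+ n ->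
    `|f (grid_point n k) - f (grid_point n k')| <= theta ^+ n.

(** Successive approximations of [t] are neighbours on the finer grid, so the increments of [f]
    along them are dominated by a geometric series; continuity carries the bound to [t]. *)
Lemma dyadic_chaining (f : 'rV[R]_N -> R) U theta n t :
  0 < theta < 1 -> {within orthant, continuous f} -> orthant t ->
  (forall j, (n <= j)%N -> U (dyadic_approx j t)) ->
  (forall j, (n <= j)%N -> grid_increments_le f U theta j) ->
  `|f t - f (dyadic_approx n t)| <= theta ^+ n / (1 - theta).
Proof.
move=> /andP[th0 th1] cf ot Ut good.
have th1' : 0 < 1 - theta by rewrite subr_gt0.
have bnd j : `|f (dyadic_approx (n + j) t) - f (dyadic_approx n t)| <=
    (theta ^+ n - theta ^+ (n + j)) / (1 - theta).
  elim: j => [|j IH]; first by rewrite addn0 !subrr normr0 mul0r.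
  rewrite addnS; apply: le_trans (ler_distD (f (dyadic_approx (n + j) t)) _ _) _.
  have -> : (theta ^+ n - theta ^+ (n + j).+1) / (1 - theta) =
      theta ^+ (n + j) + (theta ^+ n - theta ^+ (n + j)) / (1 - theta).
    by rewrite exprS; field; rewrite gt_eqF.
  apply: lerD IH.
  apply: (@le_trans _ _ (theta ^+ (n + j).+1)).
    have -> : dyadic_approx (n + j) t =
        grid_point (n + j).+1 [ffun i => (2 * dyadic_index (n + j) t i)%N].
      exact: grid_point_succ.
    apply: good; rewrite -?grid_point_succ.
    - by rewrite -addnS leq_addr.
    - by apply: Ut; rewrite -addnS leq_addr.
    - by apply: Ut; rewrite leq_addr.
    - exact: dyadic_approx_succ.
  (* The increment is controlled by the power [n + j + 1]; the weaker power [n + j] is what makes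
     the telescoped sum exact. *)
  by rewrite ler_wiXn2l// ltW.
have cv : `|f (dyadic_approx m t) - f (dyadic_approx n t)| @[m --> \oo] -->
    `|f t - f (dyadic_approx n t)|.
  by apply: cvg_norm; apply: cvgB; [exact: dyadic_approx_cvg|exact: cvg_cst].
rewrite -(cvg_lim _ cv)//; apply: limr_le; first by apply/cvg_ex; eexists; exact: cv.
exists n => // m /= nm; rewrite -(subnKC nm); apply: le_trans (bnd _) _.
by rewrite ler_wpM2r ?invr_ge0 ?(ltW th1')// lerBlDr lerDl exprn_ge0// ltW.
Qed.
End DyadicGrid.

Lemma powR_half_exp (R : realType) (g : R) n :
  (2^-1 `^ g) ^+ n = (2^-1 ^+ n) `^ g.
Proof. by rewrite -powR_mulrn ?powR_ge0// -powRrM mulrC powRrM powR_mulrn// invr_ge0. Qed.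

Lemma powR_half_lt1 (R : realType) (g : R) : 0 < g -> 0 < 2^-1 `^ g < 1.
Proof.
move=> g0; rewrite powR_gt0 ?invr_gt0//=.
have : 2^-1 `^ g < 1 `^ g.
  by apply: gt0_ltr_powR; rewrite ?nnegrE ?invr_ge0//; lra.
by rewrite powR1.
Qed.

(** Take the least [n] with [2^-1 ^+ n.+1 <= h]: minimality gives the upper bound, or the hypothesis
    does when [n = m]. *)
Lemma dyadic_bracket (R : realType) (h : R) m : 0 < h -> h < 2^-1 ^+ m ->
  exists2 n, (m <= n)%N & 2^-1 ^+ n.+1 <= h <= 2^-1 ^+ n.
Proof.
move=> h0 hm.
have ex : exists n, 2^-1 ^+ n.+1 <= h.
  have [n /ltW hn] := half_exp_small h0; exists n; apply: le_trans hn.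
  by rewrite exprS ler_piMl ?(ltW (half_exp_gt0 n))//; lra.
case: (ex_minnP ex) => n hn nmin.
have mn : (m <= n)%N.
  rewrite leqNgt; apply/negP => nm.
  suff : 2^-1 ^+ m <= 2^-1 ^+ n.+1 :> R by lra.
  by rewrite ler_wiXn2l//; lra.
exists n => //; rewrite hn/=.
move: mn; rewrite leq_eqVlt => /orP[/eqP <-|]; first exact: ltW.
case: n {hn} nmin => // n nmin _; rewrite leNgt; apply/negP => hn.
by have := nmin n (ltW hn); rewrite ltnn.
Qed.

Lemma local_holder_of_grid (R : realType) N (f : 'rV[R]_N -> R) (t0 : 'rV[R]_N)
    (r g : R) (n0 : nat) (U : set 'rV[R]_N) :
  {within orthant, continuous f} -> 0 < r -> 0 < g ->
  (forall t, orthant t -> `|t - t0| < r -> U t) ->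
  (forall n, (n0 <= n)%N -> grid_increments_le f U (2^-1 `^ g) n) ->
  exists rho M : R, [/\ 0 < rho, 0 <= M & forall t u, orthant t -> orthant u ->
    `|t - t0| < rho -> `|u - t0| < rho -> t != u ->
    `|f t - f u| <= M * `|t - u| `^ g].
Proof.
move=> cf r0 g0 sU good.
have /andP[th0 th1] := powR_half_lt1 g0; set th := 2^-1 `^ g in good th0 th1.
have th1' : 0 < 1 - th by rewrite subr_gt0.
(* Within [2^-1 ^+ m / 2] of [t0], two points are less than [2^-1 ^+ m] apart, and their
   approximations from level [m] on stay within [r] of [t0]. *)
have [m0 hm0] := half_exp_small (divr_gt0 r0 (ltr0Sn _ 1)).
pose m := maxn n0 m0.
have hm : 2^-1 ^+ m < r / 2.
  by apply: le_lt_trans hm0; rewrite ler_wiXn2l ?leq_maxr//; lra.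
exists (2^-1 ^+ m / 2), (2 `^ g * (1 + 2 / (1 - th))); split.
- by rewrite divr_gt0// half_exp_gt0.
- by rewrite mulr_ge0 ?powR_ge0// addr_ge0// divr_ge0// ltW.
move=> t u ot ou tt0 ut0 tu.
have inU v j : orthant v -> `|v - t0| < 2^-1 ^+ m / 2 -> (m <= j)%N ->
    U (dyadic_approx j v).
  move=> ov vt mj; apply: sU; first exact: grid_point_orthant.
  apply: le_lt_trans (ler_distD v _ _) _.
  have h1 : `|dyadic_approx j v - v| <= 2^-1 ^+ j by rewrite distrC dyadic_approx_dist.
  have h2 : 2^-1 ^+ j <= 2^-1 ^+ m :> R by rewrite ler_wiXn2l//; lra.
  by move: h1 h2 vt hm; move: (2^-1 ^+ j) (2^-1 ^+ m) => a b; lra.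
have h0 : 0 < `|t - u| by rewrite normr_gt0 subr_eq0.
have hlt : `|t - u| < 2^-1 ^+ m.
  have := ler_distD t0 t u; rewrite (distrC t0) => h; lra.
have [n mn /andP[lo up]] := dyadic_bracket h0 hlt.
have good' j : (n <= j)%N -> grid_increments_le f U th j.
  by move=> nj; apply: good; apply: leq_trans nj; apply: leq_trans mn; exact: leq_maxl.
have th01 : 0 < th < 1 by rewrite th0.
have bt := dyadic_chaining th01 cf ot
  (fun j nj => inU t j ot tt0 (leq_trans mn nj)) good'.
have bu := dyadic_chaining th01 cf ou
  (fun j nj => inU u j ou ut0 (leq_trans mn nj)) good'.
have btu := good' n (leqnn n) _ _ (inU t n ot tt0 mn) (inU u n ou ut0 mn)
  (dyadic_approx_near ot ou up).
apply: (@le_trans _ _ (th ^+ n * (1 + 2 / (1 - th)))).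
  have -> : th ^+ n * (1 + 2 / (1 - th)) =
      th ^+ n / (1 - th) + (th ^+ n + th ^+ n / (1 - th)).
    by field; rewrite gt_eqF.
  apply: le_trans (ler_distD (f (dyadic_approx n t)) _ _) _; apply: lerD bt _.
  apply: le_trans (ler_distD (f (dyadic_approx n u)) _ _) _; apply: lerD btu _.
  by rewrite distrC.
rewrite [leRHS]mulrAC ler_wpM2r ?addr_ge0 ?divr_ge0 ?(ltW th1')//.
rewrite /th powR_half_exp -powRM//.
apply: ge0_ler_powR; rewrite ?nnegrE ?mulr_ge0 ?(ltW g0) ?(ltW (half_exp_gt0 n))//.
by move: lo; rewrite exprS; lra.
Qed.

(** * Equivalence of norms *)

Section Norms.
Context {R : realType} {N : nat} (nm : 'rV[R]_N -> R).
Hypothesis hnm : is_norm nm.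

Lemma is_norm0 : nm 0 = 0.
Proof. by case: hnm => _ hZ _; rewrite -(scale0r 0) hZ normr0 mul0r. Qed.

Lemma is_normN x : nm (- x) = nm x.
Proof. by case: hnm => _ hZ _; rewrite -scaleN1r hZ normrN1 mul1r. Qed.

Lemma is_norm_ge0 x : 0 <= nm x.
Proof.
case: hnm => hD _ _; have := hD x (- x).
by rewrite subrr is_norm0 is_normN; lra.
Qed.

Lemma is_norm_gt0 x : x != 0 -> 0 < nm x.
Proof.
move=> x0; rewrite lt_neqAle is_norm_ge0 andbT eq_sym.
by apply: contraNneq x0 => nx; case: hnm => _ _ /(_ x nx) ->.
Qed.

Lemma is_normB x y : nm (x - y) = nm (y - x).
Proof. by rewrite -is_normN opprB. Qed.

Lemma is_norm_distD z x y : nm (x - y) <= nm (x - z) + nm (z - y).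
Proof. by case: hnm => hD _ _; have := hD (x - z) (z - y); rewrite addrA subrK. Qed.

(** Expand in the canonical basis; the added 1 keeps the constant positive. *)
Lemma is_norm_le_sup : exists2 c, 0 < c & forall x, nm x <= c * `|x|.
Proof.
case: hnm => hD hZ _.
exists (1 + \sum_(i < N) nm (delta_mx 0 i)).
  by rewrite ltr_pwDl// sumr_ge0// => i _; exact: is_norm_ge0.
move=> x; rewrite {1}(row_sum_delta x).
apply: (@le_trans _ _ (\sum_(i < N) nm (x 0 i *: delta_mx 0 i))).
  elim/big_ind2 : _ => [|a b y z h1 h2|//]; first by rewrite is_norm0.
  by apply: le_trans (hD _ _) _; exact: lerD.
rewrite mulrDl mul1r mulr_suml; apply: ler_wpDl => //.
apply: ler_sum => i _; rewrite hZ mulrC ler_wpM2l ?is_norm_ge0//.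
exact: rV_coord_le_norm.
Qed.

Lemma is_norm_continuous : continuous nm.
Proof.
have [c c0 hc] := is_norm_le_sup.
move=> x; apply/(@cvgrPdist_lt _ _ _ (nbhs x) (nbhs_filter x)) => e e0.
apply/nbhs_ballP; exists (e / c); first exact: divr_gt0.
move=> y; rewrite -ball_normE/= ltr_pdivlMr// => xy.
have := is_norm_distD y x 0; have := is_norm_distD x y 0.
rewrite !subr0 is_normB => h1 h2; have h3 := hc (x - y).
rewrite mulrC in h3; apply: le_lt_trans xy; apply: le_trans h3.
by rewrite ler_norml; lra.
Qed.

(** The continuous function [nm] attains a positive minimum on the compact unit sphere of the sup
    norm; homogeneity does the rest. *)
Lemma sup_le_is_norm : exists2 c, 0 < c & forall x, `|x| <= c * nm x.
Proof.
pose S := [set x : 'rV[R]_N | `|x| = 1].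
have inS x : x != 0 -> S (`|x|^-1 *: x).
  by move=> x0; rewrite /S/= normrZ normfV normr_id mulVf// normr_eq0.
(* If the sphere is empty, 0 is the only vector. *)
have [S0|S0] := pselect (S !=set0); last first.
  exists 1 => // x; have [->|/inS xS] := eqVneq x 0.
    by rewrite normr0 is_norm0 mulr0.
  by exfalso; apply: S0; exists (`|x|^-1 *: x).
have cS : compact S.
  apply: bounded_closed_compact.
    by exists 1; split; [exact: num_real|move=> M M1 x /= ->; exact: ltW].
  have -> : S = (fun x : 'rV[R]_N => `|x|) @^-1` [set 1] by [].
  by apply: closed_comp; [move=> x _; exact: norm_continuous|exact: closed_eq].
have [z /set_mem zS zmin] :=
  EVT_min_rV S0 cS (continuous_subspaceT is_norm_continuous).
have z0 : 0 < nm z.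
  apply: is_norm_gt0; apply/eqP => z0; move: zS; rewrite z0 /S/= normr0 => /esym/eqP.
  by rewrite oner_eq0.
exists (nm z)^-1; first by rewrite invr_gt0.
move=> x; have [->|x0] := eqVneq x 0; first by rewrite normr0 is_norm0 mulr0.
have := zmin _ (mem_set (inS x x0)).
case: hnm => _ hZ _; rewrite hZ normfV normr_id ler_pdivlMl ?normr_gt0//.
by rewrite mulrC -ler_pdivlMl.
Qed.

End Norms.

(** * Limits at a point *)

Section LimitsAtPoint.
Context {R : realType} {N : nat} (nm : 'rV[R]_N -> R).
Implicit Types (t u : 'rV[R]_N).

(** As [q] does not depend on the radius, a bound on one ball holds on all smaller ones, so a finite
    upper limit amounts to a bound on a single ball. *)
Lemma limsup_sup_lty t0 (q : 'rV[R]_N -> 'rV[R]_N -> \bar R) :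
  (limsup_sup nm t0 (fun=> q) < +oo)%E <->
  exists rho M : R, 0 < rho /\ forall t u,
    orthant_ball nm t0 rho t -> orthant_ball nm t0 rho u -> t != u ->
    (q t u <= M%:E)%E.
Proof.
split=> [|[rho [M [rho0 qM]]]].
  move=> /ereal_inf_lt[_ [V V0 <-]] Vy.
  have [M hM] : exists M : R, (ereal_sup [set ereal_sup [set q p.1 p.2 | p in
      [set p | [/\ orthant_ball nm t0 rho p.1, orthant_ball nm t0 rho p.2
                 & p.1 != p.2]]] | rho in V] <= M%:E)%E.
    (* A supremum equal to [-oo] is bounded by any real number, here 0. *)
    move: Vy; case: ereal_sup => [r _|//|_]; first by exists r.
    by exists 0; exact: leNye.
  have [e /= e0 he] := V0.
  have Ve : V (e / 2).
    apply: he => /=; last by rewrite divr_gt0.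
    by rewrite sub0r normrN gtr0_norm; lra.
  exists (e / 2), M; split; first exact: divr_gt0.
  move=> t u bt bu tu; apply: le_trans hM.
  apply: (@le_trans _ _ (ereal_sup [set q p.1 p.2 | p in
      [set p | [/\ orthant_ball nm t0 (e / 2) p.1, orthant_ball nm t0 (e / 2) p.2
                 & p.1 != p.2]]])).
    by apply: ereal_sup_ubound; exists (t, u).
  by apply: ereal_sup_ubound; exists (e / 2).
apply: (@le_lt_trans _ _ M%:E); last exact: ltry.
apply: (@le_trans _ _ (ereal_sup [set ereal_sup [set q p.1 p.2 | p in
      [set p | [/\ orthant_ball nm t0 r p.1, orthant_ball nm t0 r p.2
                 & p.1 != p.2]]] | r in `]0, rho[])).
  apply: ereal_inf_lbound; exists `]0, rho[%classic => //.
  exists rho => //= y /=; rewrite sub0r normrN => yr y0; rewrite in_itv/= y0.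
  exact: le_lt_trans (ler_norm y) yr.
apply: ge_ereal_sup => _ [r /= + <-]; rewrite in_itv/= => /andP[r0 rrho].
apply: ge_ereal_sup => _ [[t u] /= [[ot bt] [ou bu] tu] <-].
by apply: qM => //; split => //; exact: lt_trans rrho.
Qed.

Hypothesis hnm : is_norm nm.

Lemma orthant_ball_center t0 r : orthant t0 -> 0 < r -> orthant_ball nm t0 r t0.
Proof. by move=> ot0 r0; split=> //; rewrite subrr is_norm0. Qed.

Lemma subset_orthant_ball t0 r r' : r <= r' ->
  orthant_ball nm t0 r `<=` orthant_ball nm t0 r'.
Proof. by move=> rr' t [ot tr]; split=> //; exact: lt_le_trans rr'. Qed.

(** The balls contain their centre, so each infimum is at most the value there. *)
Lemma liminf_at_le (g : 'rV[R]_N -> \bar R) t0 :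
  orthant t0 -> (liminf_at nm g t0 <= g t0)%E.
Proof.
move=> ot0; rewrite /liminf_at.
have h : ereal_inf [set g u | u in orthant_ball nm t0 r] @[r --> 0^'+] -->
    ereal_sup [set ereal_inf [set g u | u in orthant_ball nm t0 r] | r in `]0, +oo[].
  apply: nonincreasing_at_right_cvge => // x y _ _ xy.
  by apply: le_ereal_inf; apply: image_subset; exact: subset_orthant_ball.
rewrite (cvg_lim _ h)//; apply: ge_ereal_sup => _ [r /= + <-].
rewrite in_itv/= andbT => r0; apply: ereal_inf_lbound.
by exists t0 => //; exact: orthant_ball_center.
Qed.

(** By monotonicity the limit is an infimum over radii, so some radius already gives a supremum
    below [b]. *)
Lemma limsup_at_lt (g : 'rV[R]_N -> \bar R) t0 b : (limsup_at nm g t0 < b)%E ->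
  exists2 r, 0 < r & forall u, orthant_ball nm t0 r u -> (g u < b)%E.
Proof.
rewrite /limsup_at.
have h : ereal_sup [set g u | u in orthant_ball nm t0 r] @[r --> 0^'+] -->
    ereal_inf [set ereal_sup [set g u | u in orthant_ball nm t0 r] | r in `]0, +oo[].
  apply: nondecreasing_at_right_cvge => // x y _ _ xy.
  by apply: le_ereal_sup; apply: image_subset; exact: subset_orthant_ball.
rewrite (cvg_lim _ h)// => /ereal_inf_lt[_ [r /= + <-]].
rewrite in_itv/= andbT => r0 rb; exists r => // u ub.
by apply: le_lt_trans rb; apply: ereal_sup_ubound; exists u.
Qed.

End LimitsAtPoint.

(** * Sample path exponents *)

Lemma ae_forall_countable d (T : measurableType d) (R : realType)
    (mu : {measure set T -> \bar R}) (I : countType) (Q : I -> T -> Prop) :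
  (forall i, {ae mu, forall w, Q i w}) -> {ae mu, forall w i, Q i w}.
Proof.
move=> aeQ.
have : {ae mu, forall w n, if unpickle n is Some i then Q i w else True}.
  by apply: ae_foralln => n; case: unpickle => [i|]; [exact: aeQ|exact: aeW].
by apply: filterS => w Qw i; have := Qw (pickle i); rewrite pickleK.
Qed.

(* The events below need not be measurable, so their probability is replaced
   by a lower bound over all measurable supersets. *)
Lemma outer_measure_gt0 d (T : measurableType d) (R : realType)
    (P : probability T R) (E : set T) : ~ P.-negligible E ->
  exists2 p : R, 0 < p & forall B, measurable B -> E `<=` B -> (p%:E <= P B)%E.
Proof.
apply: contra_notP => noP.
(* Otherwise [E] has measurable supersets of arbitrarily small probability, and their intersection
   is a null set. *)
have small n : exists B, [/\ measurable B, E `<=` B & (P B < (2^-1 ^+ n)%:E)%E].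
  apply: contrapT => noB; apply: noP; exists (2^-1 ^+ n); first exact: half_exp_gt0.
  by move=> B mB EB; rewrite leNgt; apply/negP => PB; apply: noB; exists B.
have [B hB] := choice small.
have mB : measurable (\bigcap_n B n).
  by apply: bigcap_measurable => // n _; case: (hB n).
exists (\bigcap_n B n); split => //; last first.
  by move=> w Ew n _; case: (hB n) => _ EB _; exact: EB.
apply/eqP; rewrite eq_le measure_ge0 andbT; apply/lee_addgt0Pr => e e0.
rewrite add0e; have [n hn] := half_exp_small e0.
case: (hB n) => mBn _ /ltW h; apply: (@le_trans _ _ (P (B n))).
  by apply: le_measure; rewrite ?inE//; exact: bigcap_inf.
by apply: le_trans h _; rewrite lee_fin ltW.
Qed.

Lemma measure_bigsetU_le d (T : measurableType d) (R : realType)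
    (P : {measure set T -> \bar R}) (I : Type) (s : seq I) (B : I -> set T) (b : R) :
  (forall i, measurable (B i)) -> (forall i, P (B i) <= b%:E)%E ->
  (P (\big[setU/set0]_(i <- s) B i) <= ((size s)%:R * b)%:E)%E.
Proof.
move=> mB PB; elim: s => [|i s IH]; first by rewrite big_nil measure0 mul0r.
rewrite big_cons /= (_ : _.+1%:R * b = b + (size s)%:R * b) ?EFinD; last first.
  by rewrite -natr1; ring.
apply: le_trans (measureU2 _ _ _) _ => //; first exact: bigsetU_measurable.
exact: leeD (PB i) IH.
Qed.

Lemma norm_equiv_sup (R : realType) N (nm : 'rV[R]_N -> R) : is_norm nm ->
  exists2 c : R, 0 < c & forall x, nm x <= c * `|x| /\ `|x| <= c * nm x.
Proof.
move=> hnm; have [a a0 ha] := is_norm_le_sup hnm.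
have [b b0 hb] := sup_le_is_norm hnm.
exists (a + b); first exact: addr_gt0.
move=> x; split; [apply: le_trans (ha x) _|apply: le_trans (hb x) _].
  by rewrite ler_wpM2r// lerDl ltW.
by rewrite ler_wpM2r ?is_norm_ge0// lerDr ltW.
Qed.

(** * From Hölder paths to second moments *)

Section Increments.
Context {R : realType} {N : nat} {d : measure_display} {T : measurableType d}.
Variables (P : probability T R) (X : 'rV[R]_N -> T -> R) (nm : 'rV[R]_N -> R).
Hypotheses (hnm : is_norm nm) (hgauss : gaussian_process P X).

Lemma gaussian_increment t u : orthant t -> orthant u ->
  gaussian_variable P (fun w => X t w - X u w).
Proof.
move=> ot ou.
have := hgauss (fun i : 'I_2 => if i == ord0 then 1 else -1)
  (fun i : 'I_2 => _ : orthant (if i == ord0 then t else u)).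
have h : forall i : 'I_2, orthant (if i == ord0 then t else u) by move=> i; case: ifP.
move=> /(_ h); congr (gaussian_variable P _); apply/funext => w.
by rewrite 2!big_ord_recl big_ord0 /= addr0 mul1r mulN1r.
Qed.

Let second_moment t u := (\int[P]_w ((X t w - X u w) ^+ 2)%:E)%E.

Lemma det_local_holder_quotient (t u : 'rV[R]_N) a M : t != u ->
  ('E_P[fun w => ((X t w - X u w) ^+ 2)%R] * ((nm (t - u) `^ (2 * a))^-1)%:E
     <= M%:E)%E = (second_moment t u <= (M * nm (t - u) `^ (2 * a))%:E)%E.
Proof.
move=> tu; rewrite unlock lee_pdivrMr ?EFinM//.
by rewrite powR_gt0// is_norm_gt0// subr_eq0.
Qed.

(** Fixing [rho] and [M] turns Hölder regularity into events of which countably many suffice. *)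
Definition path_holder t0 b rho M w := forall t u,
  orthant_ball nm t0 rho t -> orthant_ball nm t0 rho u -> t != u ->
  `|X t w - X u w| <= M * nm (t - u) `^ b.

Lemma path_holder_negligible t0 (b rho M : R) : 0 < rho -> 0 <= M ->
  (det_local_holder nm P X t0 < b%:E)%E ->
  P.-negligible [set w | path_holder t0 b rho M w].
Proof.
move=> rho0 M0; apply: contraPP => /outer_measure_gt0[p p0 hp].
apply/negP; rewrite -leNgt; apply: ereal_sup_ubound; exists b => //=.
apply/(limsup_sup_lty nm t0); exists rho, (18 * (9 * M / p ^+ 2) ^+ 2).
split=> // t u bt bu tu; rewrite det_local_holder_quotient//.
have [[ot _] [ou _]] := (bt, bu).
pose a := M * nm (t - u) `^ b.
have a0 : 0 <= a by rewrite mulr_ge0 ?powR_ge0.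
have gY := gaussian_increment ot ou.
have := gaussian_second_moment_le gY a0 p0.
have -> : 18 * (9 * a / p ^+ 2) ^+ 2 =
    18 * (9 * M / p ^+ 2) ^+ 2 * nm (t - u) `^ (2 * b).
  rewrite mulrC -(mulrC b) powRrM powR_mulrn ?powR_ge0// /a.
  by field; rewrite gt_eqF.
apply; apply: hp; last by move=> w /(_ t u bt bu tu).
case: gY => mY _; apply: measurable_fun_le.
exact: measurableT_comp.
Qed.

End Increments.

(** * Borel-Cantelli on the dyadic grids *)

Section GridIncrements.
Context {R : realType} {N : nat} {d : measure_display} {T : measurableType d}.
Variables (P : probability T R) (X : 'rV[R]_N -> T -> R).
Hypothesis hgauss : gaussian_process P X.
Variables (U : set 'rV[R]_N) (Q : nat) (K a g : R).
Hypotheses (Uorthant : U `<=` orthant).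
Hypothesis Ubound : forall t i, U t -> t 0 i < Q%:R.
Hypotheses (K0 : 0 < K) (g0 : 0 < g) (ga : g < a).
Hypothesis secU : forall t u, U t -> U u -> t != u ->
  (\int[P]_w ((X t w - X u w) ^+ 2)%:E <= (K * `|t - u| `^ (2 * a))%:E)%E.

(** Points of [U] have coordinates below [Q], so a finite type of indices covers its part of the
    grid and a union bound is possible. *)
Let index n := {ffun 'I_N -> 'I_(Q * 2 ^ n)}.

Let point n (k : index n) : 'rV[R]_N := grid_point n [ffun i => nat_of_ord (k i)].

(** Equal points are excluded because [secU] only concerns distinct ones. *)
Let close n (p : index n * index n) : Prop :=
  [/\ U (point p.1), U (point p.2), point p.1 != point p.2 &
      `|point p.1 - point p.2| <= 2^-1 ^+ n].

(** Closeness is part of the event, so that a pair that is not close contributes the empty set. *)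
Let bad1 n (p : index n * index n) : set T :=
  [set w | close p /\ (2^-1 `^ g) ^+ n <= `|X (point p.1) w - X (point p.2) w|].

Let bad n : set T := \big[setU/set0]_(p <- enum {: index n * index n}) bad1 p.

Let bad1_measurable n (p : index n * index n) : measurable (bad1 p).
Proof.
have [hp|hp] := pselect (close p); last first.
  by rewrite (_ : bad1 p = set0)//; apply/seteqP; split => w // [].
rewrite (_ : bad1 p =
    [set w | (2^-1 `^ g) ^+ n <= `|X (point p.1) w - X (point p.2) w|]); last first.
  by apply/seteqP; split => w //= [].
have [U1 U2 _ _] := hp.
have [mY _] := gaussian_increment hgauss (Uorthant U1) (Uorthant U2).
by apply: measurable_fun_ge; exact: measurableT_comp.
Qed.

Let bad_measurable n : measurable (bad n).
Proof. by apply: bigsetU_measurable => p _; exact: bad1_measurable. Qed.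

(* Ratio of the variance bound to the squared threshold at consecutive levels. *)
Let eta : R := 2^-1 `^ (2 * (a - g)).

Let bad1_le n (p : index n * index n) j :
  (P (bad1 p) <= (2 * j`!%:R * (128 ^+ 2 * K) ^+ j * (eta ^+ j) ^+ n)%:E)%E.
Proof.
have [hp|hp] := pselect (close p); last first.
  rewrite (_ : bad1 p = set0) ?measure0; last by apply/seteqP; split => w // [].
  by rewrite lee_fin !mulr_ge0 ?exprn_ge0 ?powR_ge0// ?(ltW K0)//
    mulr_ge0 ?exprn_ge0 ?(ltW K0).
have [U1 U2 ne cl] := hp.
have a0 : 0 < a := lt_trans g0 ga.
have gY := gaussian_increment hgauss (Uorthant U1) (Uorthant U2).
pose th := 2^-1 `^ g : R.
have th0 : 0 < th by rewrite powR_gt0// invr_gt0.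
pose V := K * (2^-1 ^+ n) `^ (2 * a).
have V0 : 0 < V by rewrite mulr_gt0// powR_gt0// half_exp_gt0.
have secV : (\int[P]_w ((X (point p.1) w - X (point p.2) w) ^+ 2)%:E <= V%:E)%E.
  apply: le_trans (secU U1 U2 ne) _; rewrite lee_fin ler_pM2l//.
  apply: ge0_ler_powR; rewrite ?nnegrE ?(ltW (half_exp_gt0 _))//.
  by rewrite mulr_ge0// ltW.
have := gaussian_tail j gY V0 (exprn_gt0 n th0) secV.
have -> : 128 ^+ 2 * V / (th ^+ n) ^+ 2 = 128 ^+ 2 * K * eta ^+ n.
  rewrite /V -powR_half_exp -exprM mulnC exprM mulrA -mulrA; congr (_ * _).
  rewrite -expr_div_n; congr (_ ^+ n).
  have -> : 2 * a = 2 * (a - g) + (g + g) by ring.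
  rewrite powRD; last by apply/implyP => _; rewrite invr_eq0.
  rewrite powRD; last by apply/implyP => _; rewrite invr_eq0.
  by rewrite -expr2 mulfK// expf_neq0// gt_eqF.
rewrite exprMn -exprM mulnC exprM mulrA; apply: le_trans.
apply: le_measure; rewrite ?inE; [exact: bad1_measurable| |by move=> w []].
by case: gY => mY _; apply: measurable_fun_ge; exact: measurableT_comp.
Qed.

(** There are [(Q * 2 ^ n) ^ (2 * N)] pairs at level [n]. An order [j] with [eta ^+ j] below
    [2^-1 ^+ (2 * N + 1)] beats this count and leaves a factor [2^-1 ^+ n]. *)
Let bad_le : exists C : R, forall n, (P (bad n) <= (C * 2^-1 ^+ n)%:E)%E.
Proof.
have eta0 : 0 <= eta by exact: powR_ge0.
have eta1 : eta < 1.
  have /powR_half_lt1/andP[] // : 0 < 2 * (a - g) by rewrite mulr_gt0// subr_gt0.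
have [j hj] : exists j, eta ^+ j < 2^-1 ^+ (N * 2).+1.
  have h : eta ^+ n @[n --> \oo] --> (0 : R) by apply: cvg_expr; rewrite ger0_norm.
  move/cvgrPdist_lt: h => /(_ _ (half_exp_gt0 (N * 2).+1))[n _ hn].
  exists n; move: (hn n (leqnn n)).
  by rewrite /= sub0r normrN ger0_norm ?exprn_ge0.
pose c := 2 * j`!%:R * (128 ^+ 2 * K) ^+ j.
have c0 : 0 <= c by rewrite !mulr_ge0 ?exprn_ge0 ?mulr_ge0 ?exprn_ge0 ?(ltW K0).
exists (Q%:R ^+ (N * 2) * c) => n.
apply: le_trans (measure_bigsetU_le _ (@bad1_measurable n) (fun p => bad1_le p j)) _.
rewrite lee_fin -cardE card_prod card_ffun !card_ord -/c.
rewrite -expnD addnn -muln2 natrX natrM natrX exprMn.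
have : (eta ^+ j) ^+ n <= (2^-1 ^+ (N * 2).+1) ^+ n.
  by apply: lerXn2r; rewrite ?nnegrE ?exprn_ge0 ?invr_ge0// ltW.
rewrite [X in _ <= X]exprAC exprS => he.
have := congr1 (fun x : R => x ^+ (N * 2)) (half_exp_mul n).
rewrite expr1n exprMn; set x := 2 ^+ n ^+ _; set y := (2^-1 ^+ n) ^+ _ => xy.
apply: (@le_trans _ _ (Q%:R ^+ (N * 2) * x * (c * (2^-1 ^+ n * y)))).
  by rewrite ler_wpM2l ?mulr_ge0 ?exprn_ge0// ler_wpM2l.
have -> : Q%:R ^+ (N * 2) * x * (c * (2^-1 ^+ n * y)) =
    Q%:R ^+ (N * 2) * c * 2^-1 ^+ n * (x * y) by ring.
by rewrite xy mulr1.
Qed.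

(** The probabilities of [bad n] are summable, so almost surely only finitely many levels are
    bad. *)
Lemma grid_increments_eventually : {ae P, forall w, exists n0, forall n,
  (n0 <= n)%N -> grid_increments_le (X ^~ w) U (2^-1 `^ g) n}.
Proof.
have null : P (lim_sup_set bad) = 0%E.
  apply: lim_sup_set_cvg0 => //; have [C hC] := bad_le.
  apply: (@le_lt_trans _ _ (\sum_(n <oo) (C * 2^-1 ^+ n)%:E)%E).
    by apply: lee_nneseries => n *; [exact: measure_ge0|exact: hC].
  (* This series starts at the power [2 ^ 1], hence the numerator [2 * C]. *)
  have h := @cvg_geometric_eseries_half R (2 * C) 0.
  rewrite (_ : lim _ = (2 * C / 2 ^+ 0)%:E) ?ltry//.
  rewrite -(cvg_lim _ h)//; congr (limn _); apply/funext => m.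
  apply: eq_bigr => k _; rewrite addn1 natrX exprS exprVn; congr EFin.
  by field; rewrite expf_neq0.
exists (lim_sup_set bad); split => //.
  by apply: bigcap_measurable => // n _; apply: bigcup_measurable.
move=> w nw; apply: contrapT => /= nlim; apply: nw.
have : exists2 n, True & ~ exists2 j, (n <= j)%N & bad j w.
  apply: contrapT => h; apply: nlim => n _.
  by apply: contrapT => h'; apply: h; exists n => // -[j nj bj]; apply: h'; exists j.
move=> [n0 _ hn0]; exists n0 => n nn k k' Uk Uk' kk'.
have [->|ne] := eqVneq (grid_point n k : 'rV[R]_N) (grid_point n k').
  by rewrite subrr normr0 exprn_ge0// powR_ge0.
rewrite leNgt; apply/negP => /ltW big; apply: hn0; exists n => //.
have bk (l : {ffun 'I_N -> nat}) i : U (grid_point n l) -> (l i < Q * 2 ^ n)%N.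
  move=> /Ubound => /(_ i); rewrite mxE => h.
  rewrite -(ltr_nat R) natrM natrX.
  have -> : (l i)%:R = (l i)%:R * 2^-1 ^+ n * 2 ^+ n :> R.
    by rewrite -mulrA (mulrC (2^-1 ^+ n)) half_exp_mul mulr1.
  by rewrite ltr_pM2r ?exprn_gt0.
pose idx l (Ul : U (grid_point n l)) : index n := [ffun i => Ordinal (bk l i Ul)].
have idxE l Ul : point (idx l Ul) = grid_point n l.
  by apply/rowP => i; rewrite !mxE !ffunE.
rewrite /bad -bigcup_seq; exists (idx _ Uk, idx _ Uk') => /=; first by rewrite mem_enum.
by rewrite /bad1/= /close/= !idxE.
Qed.

End GridIncrements.

(** * Almost sure bounds on the local exponent *)

Lemma exists_rat_between (R : realType) (x y : \bar R) : (x < y)%E ->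
  exists b : rat, (x < (ratr b)%:E < y)%E.
Proof.
move: x y => [x| |] [y| |] //; rewrite ?lte_fin => xy.
- have [b] := rat_in_itvoo xy; rewrite in_itv/= => hb.
  by exists b; rewrite !lte_fin.
- have [|b] := @rat_in_itvoo _ x (x + 1); first by rewrite ltrDl.
  by rewrite in_itv/= => /andP[hb _]; exists b; rewrite lte_fin hb ltry.
- have [|b] := @rat_in_itvoo _ (y - 1) y; first by rewrite ltrBlDr ltrDl.
  by rewrite in_itv/= => /andP[_ hb]; exists b; rewrite lte_fin hb ltNyr.
- by exists 0; rewrite ltNyr ltry.
Qed.

Lemma ge_local_holder (R : realType) N (nm : 'rV[R]_N -> R) (f : 'rV[R]_N -> R)
    t0 (g rho M : R) : is_norm nm -> 0 < rho ->
  (forall t u, orthant_ball nm t0 rho t -> orthant_ball nm t0 rho u -> t != u ->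
    `|f t - f u| <= M * nm (t - u) `^ g) ->
  (g%:E <= local_holder nm f t0)%E.
Proof.
move=> hnm rho0 hf; apply: ereal_sup_ubound; exists g => //=.
apply/(limsup_sup_lty nm t0); exists rho, M; split => // t u bt bu tu.
rewrite lee_fin ler_pdivrMr; first exact: hf.
by rewrite powR_gt0// is_norm_gt0// subr_eq0.
Qed.

(** Some admissible exponent [al] exceeds [b]. Radius at most 1/2 keeps [nm (t - u)] at most 1,
    where lowering the exponent only increases the power. *)
Lemma gt_local_holder (R : realType) N (nm : 'rV[R]_N -> R) (f : 'rV[R]_N -> R)
    t0 (b : R) : is_norm nm -> (b%:E < local_holder nm f t0)%E ->
  exists rho M : R, [/\ 0 < rho, 0 <= M &
    forall t u, orthant_ball nm t0 rho t -> orthant_ball nm t0 rho u -> t != u ->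
    `|f t - f u| <= M * nm (t - u) `^ b].
Proof.
move=> hnm /ereal_sup_gt[_ [al /= hal <-]]; rewrite lte_fin => bal.
have [rho [M [rho0 hM]]] := (limsup_sup_lty nm t0 _).1 hal.
exists (Num.min rho 2^-1), (Num.max M 0); split.
- by rewrite lt_min rho0 invr_gt0 ltr0n.
- by rewrite le_max lexx orbT.
move=> t u bt bu tu.
have h0 : 0 < nm (t - u) by rewrite is_norm_gt0// subr_eq0.
have h1 : nm (t - u) <= 1.
  have := is_norm_distD hnm t0 t u; rewrite (is_normB hnm t0).
  have [_] := bt; have [_] := bu; rewrite !lt_min => /andP[_ h] /andP[_ h']; lra.
have sub : orthant_ball nm t0 (Num.min rho 2^-1) `<=` orthant_ball nm t0 rho.
  by apply: subset_orthant_ball; rewrite ge_min lexx.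
have := hM t u (sub _ bt) (sub _ bu) tu.
rewrite lee_fin ler_pdivrMr ?powR_gt0// => h; apply: le_trans h _.
apply: (@le_trans _ _ (Num.max M 0 * nm (t - u) `^ al)).
  by rewrite ler_wpM2r ?powR_ge0// le_max lexx.
rewrite ler_wpM2l ?le_max ?lexx ?orbT//.
by apply: ger_powR; [rewrite h0|exact: ltW].
Qed.

Section LocalExponent.
Context {R : realType} {N : nat} {d : measure_display} {T : measurableType d}.
Variables (P : probability T R) (X : 'rV[R]_N -> T -> R) (nm : 'rV[R]_N -> R).
Hypotheses (hnm : is_norm nm) (hgauss : gaussian_process P X).

Lemma local_holder_le_limsup : {ae P, forall w t0, orthant t0 ->
  (local_holder nm (X ^~ w) t0 <= limsup_at nm (det_local_holder nm P X) t0)%E}.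
Proof.
(* An index consists of a dyadic point, a rational exponent, a radius [2^-1 ^+ r] and an integer
   constant. *)
pose I : countType := ((nat * {ffun 'I_N -> nat}) * rat * (nat * nat))%type.
have : {ae P, forall w (i : I), let: (q, b, (r, M)) := i in
    (det_local_holder nm P X (grid_point q.1 q.2) < (ratr b)%:E)%E ->
    ~ path_holder X nm (grid_point q.1 q.2) (ratr b) (2^-1 ^+ r) M%:R w}.
  apply: ae_forall_countable => -[[q b] [r M]].
  have [hq|hq] := pselect (det_local_holder nm P X (grid_point q.1 q.2) < (ratr b)%:E)%E.
    have := path_holder_negligible hnm hgauss (half_exp_gt0 r) (ler0n R M) hq.
    apply: negligibleS.
    by move=> w /= h; apply: contrapT => h'; exact: h.
  by apply: aeW => w.
apply: filterS => w good t0 ot0; rewrite leNgt; apply/negP => lt.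
(* A rational [b] in the gap is a Hölder exponent of the path near [t0], yet exceeds the
   deterministic exponent at all points near [t0]; a dyadic [q] close to [t0] contradicts [good]. *)
have [b /andP[lb bl]] := exists_rat_between lt.
have [rho [M [rho0 M0 hM]]] := gt_local_holder hnm bl.
have [r r0 hr] := limsup_at_lt lb.
have [c c0 hc] := norm_equiv_sup hnm.
(* Halving puts [q] within [s] of [t0] and a ball of radius less than [s] around [q] inside the ball
   of radius [2 * s] around [t0]. *)
pose s := Num.min rho r / 2.
have s0 : 0 < s by rewrite divr_gt0// lt_min rho0.
have [n hn] := half_exp_small (divr_gt0 s0 c0).
have [l hl] := half_exp_small s0.
pose q := dyadic_approx n t0.
have qt0 : nm (q - t0) < s.
  rewrite (is_normB hnm); apply: le_lt_trans (hc _).1 _.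
  rewrite mulrC -ltr_pdivlMr//; apply: le_lt_trans hn; exact: dyadic_approx_dist.
have sub : orthant_ball nm q (2^-1 ^+ l) `<=` orthant_ball nm t0 (Num.min rho r).
  move=> t [ot tq]; split => //; apply: le_lt_trans (is_norm_distD hnm q _ _) _.
  by rewrite [Num.min _ _]splitr -/s; apply: ltrD qt0; exact: lt_trans tq hl.
have [k hk] : exists k : nat, M <= k%:R.
  by exists (Num.truncn M).+1; apply: ltW; exact: truncnS_gt.
apply: (good ((n, dyadic_index n t0), b, (l, k))).
  apply: hr; split; first exact: grid_point_orthant.
  apply: lt_le_trans qt0 _; have : Num.min rho r <= r by rewrite ge_min lexx orbT.
  by move: s0; rewrite /s; move: (Num.min rho r) => x; lra.
move=> t u /sub[ot bt] /sub[ou bu] tu.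
apply: (@le_trans _ _ (M * nm (t - u) `^ ratr b)); last by rewrite ler_wpM2r ?powR_ge0.
apply: hM => //; split=> //; [apply: lt_le_trans bt _|apply: lt_le_trans bu _];
  by rewrite ge_min lexx.
Qed.

Lemma liminf_le_local_holder : continuous_process P X ->
  (forall t0, orthant t0 -> (0 < liminf_at nm (det_local_holder nm P X) t0)%E) ->
  {ae P, forall w t0, orthant t0 ->
    (liminf_at nm (det_local_holder nm P X) t0 <= local_holder nm (X ^~ w) t0)%E}.
Proof.
move=> hcont hpos.
(* The radius is twice the mesh: if [q] approximates [t0] within the mesh, [U q] still contains a
   ball of radius one mesh around [t0]. *)
pose U (q : nat * {ffun 'I_N -> nat}) : set 'rV[R]_N :=
  [set t | orthant t /\ `|t - grid_point q.1 q.2| < 2 * 2^-1 ^+ q.1].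
(* This condition is deterministic, so it can be decided before choosing the null set of each
   index. *)
pose regular q (g : R) := exists K a : R, [/\ 0 < K, 0 < g, g < a & forall t u,
  U q t -> U q u -> t != u ->
  (\int[P]_w ((X t w - X u w) ^+ 2)%:E <= (K * `|t - u| `^ (2 * a))%:E)%E].
pose I : countType := ((nat * {ffun 'I_N -> nat}) * rat)%type.
have : {ae P, forall w (i : I), regular i.1 (ratr i.2) -> exists n0, forall n,
    (n0 <= n)%N -> grid_increments_le (X ^~ w) (U i.1) (2^-1 `^ ratr i.2) n}.
  apply: ae_forall_countable => -[q b] /=.
  have [[K [a [K0 g0 ga hK]]]|nreg] := pselect (regular q (ratr b)); last exact: aeW.
  (* Each coordinate on [U q] is less than that of the grid point plus [2 * 2^-1 ^+ q.1], hence less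
     than [q.2 i + 2]. *)
  pose Q := (\sum_(i < N) q.2 i + 2)%N.
  have Ub t i : U q t -> t 0 i < Q%:R.
    move=> [_ ht].
    have := le_lt_trans (rV_coord_le_norm _ i) ht; rewrite !mxE.
    have qi : (q.2 i)%:R * 2^-1 ^+ q.1 <= (q.2 i)%:R :> R.
      by rewrite ler_piMr// exprn_ile1 ?invr_ge0//; lra.
    have two : 2 * 2^-1 ^+ q.1 <= 2 :> R.
      by rewrite ler_piMr// exprn_ile1 ?invr_ge0//; lra.
    have : (q.2 i)%:R + 2 <= Q%:R :> R.
      by rewrite /Q natrD lerD2r ler_nat (bigD1 i)//= leq_addr.
    rewrite ltr_norml => + /andP[_]; lra.
  have := grid_increments_eventually hgauss (fun t => @proj1 _ _) Ub K0 g0 ga hK.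
  by apply: filterS => w h _.
move: hcont; apply: filterS2 => w cw good t0 ot0.
rewrite leNgt; apply/negP => lt.
have [b [g0 lb [al [bal hal]]]] : exists b : rat, [/\ 0 < ratr b :> R,
    (local_holder nm (X ^~ w) t0 < (ratr b)%:E)%E &
    exists al : R, ratr b < al /\ (limsup_sup nm t0 (fun _ t u =>
      'E_P[fun w => ((X t w - X u w) ^+ 2)%R]
        * ((nm (t - u) `^ (2 * al))^-1)%:E) < +oo)%E].
  (* Positivity of the lower limit leaves room for a rational that is positive as well, as chaining
     requires. *)
  have : (Order.max 0%:E (local_holder nm (X ^~ w) t0) < det_local_holder nm P X t0)%E.
    apply: lt_le_trans (liminf_at_le hnm _ ot0).
    by rewrite gt_max lt (hpos _ ot0).
  move=> /ereal_sup_gt[_ [al hal <-]] /exists_rat_between[b /andP[]].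
  rewrite gt_max !lte_fin => /andP[b0 lb] bal.
  by exists b; split => //; exists al.
have [rho [M [rho0 hM]]] := (limsup_sup_lty nm t0 _).1 hal.
have [c c0 hc] := norm_equiv_sup hnm.
(* Points of [U q] lie within [3 * 2^-1 ^+ m] of [t0] in the sup norm; the bound on the mesh turns
   this into [nm]-distance less than [rho]. *)
have [m hm] := half_exp_small (divr_gt0 rho0 (mulr_gt0 (ltr0Sn R 2) c0)).
pose q := (m, dyadic_index m t0).
have m0 := half_exp_gt0 (R := R) m.
have Uball t : U q t -> orthant_ball nm t0 rho t.
  move=> [ot tq]; split => //; apply: le_lt_trans (hc _).1 _.
  rewrite mulrC -ltr_pdivlMr//.
  have h3 : 3 * 2^-1 ^+ m < rho / c.
    by move: hm; rewrite !ltr_pdivlMr ?mulr_gt0// mulrCA mulrA.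
  apply: le_lt_trans (ler_distD (grid_point q.1 q.2) _ _) _.
  have h : `|grid_point q.1 q.2 - t0| <= 2^-1 ^+ m.
    by rewrite distrC; exact: dyadic_approx_dist.
  by move: tq; rewrite /= => tq; lra.
have [|n0 hn0] := good (q, b).
  exists ((Num.max M 0 + 1) * c `^ (2 * al)), al.
  have al0 : 0 < al := lt_trans g0 bal.
  have M1 : 0 < Num.max M 0 + 1.
    by rewrite ltr_wpDl// le_max lexx orbT.
  split => //=; first by rewrite mulr_gt0// powR_gt0.
  move=> t u Ut Uu tu.
  have := hM t u (Uball t Ut) (Uball u Uu) tu.
  rewrite det_local_holder_quotient// => h; apply: le_trans h _.
  rewrite lee_fin -mulrA -powRM ?(ltW c0)//.
  apply: (@le_trans _ _ ((Num.max M 0 + 1) * nm (t - u) `^ (2 * al))).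
    rewrite ler_wpM2r ?powR_ge0//.
    by apply: (@le_trans _ _ (Num.max M 0)); rewrite ?lerDl// le_max lexx.
  rewrite ler_wpM2l ?(ltW M1)//.
  apply: ge0_ler_powR; rewrite ?nnegrE ?is_norm_ge0 ?mulr_ge0 ?(ltW c0) ?(ltW al0)//.
  by case: (hc (t - u)).
have [|r [M' [r0 M'0 hr]]] := local_holder_of_grid (t0 := t0) cw m0 g0 _ hn0.
  move=> t ot tt0; split=> //=; apply: le_lt_trans (ler_distD t0 _ _) _.
  by have := dyadic_approx_dist m ot0; rewrite /dyadic_approx; lra.
move: lb; rewrite ltNge => /negP; apply.
(* The factor [c] converts the radius and the increment bound from the sup norm to [nm]. *)
apply: (ge_local_holder (rho := r / c) (M := M' * c `^ ratr b)) => //.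
  exact: divr_gt0.
have toball t : orthant_ball nm t0 (r / c) t -> `|t - t0| < r.
  move=> [_]; rewrite ltr_pdivlMr// mulrC => h; apply: le_lt_trans h.
  by case: (hc (t - t0)).
move=> t u bt bu tu; have [[ot _] [ou _]] := (bt, bu).
apply: le_trans (hr t u ot ou (toball _ bt) (toball _ bu) tu) _.
rewrite -mulrA -powRM ?is_norm_ge0 ?(ltW c0)// ler_wpM2l//.
apply: ge0_ler_powR; [exact: ltW|by rewrite nnegrE| |by case: (hc (t - u))].
by rewrite nnegrE mulr_ge0 ?is_norm_ge0// ltW.
Qed.

End LocalExponent.

Theorem theorem3p14 (R : realType) (N : nat) (hN : (1 <= N)%N)
    (nm : 'rV[R]_N -> R) (hnm : is_norm nm)
    (d : measure_display) (T : measurableType d) (P : probability T R)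
    (X : 'rV[R]_N -> T -> R)
    (hgauss : gaussian_process P X) (hcont : continuous_process P X)
    (hD : forall t0, orthant t0 ->
      {ae P, forall w, graph_meets_D nm (fun t => X t w) t0})
    (hpos : forall t0, orthant t0 ->
      (0 < liminf_at nm (det_local_holder nm P X) t0)%E) :
  {ae P, forall w, forall t0, orthant t0 ->
    (liminf_at nm (det_local_holder nm P X) t0
       <= local_holder nm (fun t => X t w) t0)%E /\
    (local_holder nm (fun t => X t w) t0
       <= limsup_at nm (det_local_holder nm P X) t0)%E}.
Proof.
have := liminf_le_local_holder hnm hgauss hcont hpos.
have := local_holder_le_limsup hnm hgauss.
apply: filterS2 => w upper lower t0 ot0.
by split; [exact: lower|exact: upper].
Qed.
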